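(* Let $P$ be a loop-free passive program with blocks $\mathrm{Block}_0,\dots,\mathrm{Block}_n$ and reachability verification condition $VC$ (with auxiliary Boolean variables $B_0,\dots,B_n$ and reachability variables $R_0,\dots,R_n$). Let $\sigma$ be an initial state of $P$, i.e. a valuation of the program variables. There is a valuation $\nu$ that extends $\sigma$ to the auxiliary variables, satisfies $VC$ and has $\nu(R_0)=\mathrm{true}$ if and only if there is a complete path $\pi$ of $P$ that is feasible from $\sigma$. Moreover, for such a $\nu$ and every $i\in\{0,\dots,n\}$, $\nu(R_i)=\mathrm{true}$ if and only if there is a complete path of $P$ that is feasible from $\sigma$ and visits $\mathrm{Block}_i$.
   Context: Programs. A (passive) program consists of finitely many blocks $\mathrm{Block}_0,\dots,\mathrm{Block}_n$. Each $\mathrm{Block}_i$ consists of a (possibly empty) finite sequence of statements $S_i$ followed by a non-deterministic goto to the blocks with indices in a set $Succ_i\subseteq\{0,\dots,n\}$. $\mathrm{Block}_0$ is the unique initial block and $\mathrm{Block}_n$ is the unique final block, i.e. the only block with $Succ_n=\emptyset$. Passive means that all statements have the form $\mathbf{assume}\ E$, where $E$ is a Boolean-sorted first-order expression over the program variables, interpreted in a fixed background structure; no statement changes a variable, so a state is a valuation of all program variables and stays constant during an execution. (Such programs arise from arbitrary loop-free programs by a single static assignment transformation, in which each assigned variable is split into incarnations and each assignment is replaced by an assumption.) Loop-free means that the directed graph on $\{0,\dots,n\}$ with edges $i\to j$ for $j\in Succ_i$ is acyclic. Put $Pre_i=\{j : i\in Succ_j\}$. Paths. A path is a sequence of blocks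 in which each block is followed by one of its successors; it is complete if it starts in $\mathrm{Block}_0$ and ends in $\mathrm{Block}_n$. A path is feasible from a state $\sigma$ if every assumed expression $E$ in every block of the path is true under $\sigma$. Weakest liberal precondition. $wlp(\mathbf{assume}\ E, Q) = (E\Rightarrow Q)$ and $wlp(S;T,Q)=wlp(S,wlp(T,Q))$ (and $wlp$ of the empty sequence with respect to $Q$ is $Q$). Reachability verification condition. Introduce fresh Boolean variables $B_0,\dots,B_n$ and $R_0,\dots,R_n$. Let $$WLP:\quad \bigwedge_{0\le i<n}\Bigl(B_i \equiv \neg wlp\bigl(S_i,\bigwedge_{j\in Succ_i}\neg B_j\bigr)\Bigr)\ \wedge\ \bigl(B_n\equiv\neg wlp(S_n,\mathrm{false})\bigr),$$ $$VC:\quad WLP\ \wedge\ (R_0\equiv B_0)\ \wedge\ \bigwedge_{1\le i\le n}\Bigl(R_i\equiv B_i\wedge\bigvee_{j\in Pre_i}R_j\Bigr).$$ $R_i$ is called the reachability variable of $\mathrm{Block}_i$. An empty disjunction is false. *)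

(* Defs.v *)
(* [boolp] supplies the classical truth value `[< A >] : bool of a proposition
   A, used to interpret equality and quantifiers at the sort [Bool]. *)
From mathcomp Require Import all_boot.
From mathcomp Require Import boolp.

Set Implicit Arguments.
Unset Strict Implicit.
Unset Printing Implicit Defensive.

Inductive sort_of (U : Type) : Type := Bool | Base of U.
Arguments Bool {U}.
Arguments Base {U} u.

(* Predicate symbols are function symbols whose result sort is [Bool]. *)
Record signature := Signature {
  base_sort : Type;
  fsym : Type;
  arity : fsym -> nat;
  arg_sort : forall f : fsym, 'I_(arity f) -> sort_of base_sort;
  res_sort : fsym -> sort_of base_sort
}.
Arguments arg_sort {s f} k.
Arguments res_sort {s} f.

Definition sorts (Sg : signature) : Type := sort_of (base_sort Sg).

(* Variables are given as sort-indexed families [V : sorts Sg -> Type], where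
   [V s] is the type of variables of sort [s].  [bind V s] adds to [V] one new
   variable of sort [s], the one bound by a quantifier. *)
Inductive bind (Sg : signature) (V : sorts Sg -> Type) (s : sorts Sg) :
    sorts Sg -> Type :=
| Bound : bind V s s
| Free (t : sorts Sg) (x : V t) : bind V s t.
Arguments Bound {Sg V s}.
Arguments Free {Sg V s t} x.

Inductive expr (Sg : signature) (V : sorts Sg -> Type) : sorts Sg -> Type :=
| Var (s : sorts Sg) (x : V s) : expr V s
| App (f : fsym Sg) (a : forall k : 'I_(arity f), expr V (arg_sort k)) :
    expr V (res_sort f)
| Eq (s : sorts Sg) (a b : expr V s) : expr V Bool
| TrueE : expr V Bool
| FalseE : expr V Bool
| Not (a : expr V Bool) : expr V Bool
| And (a b : expr V Bool) : expr V Bool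
| Or (a b : expr V Bool) : expr V Bool
| Imp (a b : expr V Bool) : expr V Bool
| Iff (a b : expr V Bool) : expr V Bool
| Forall (s : sorts Sg) (a : expr (bind V s) Bool) : expr V Bool
| Exists (s : sorts Sg) (a : expr (bind V s) Bool) : expr V Bool.
Arguments Var {Sg V s} x.
Arguments App {Sg V} f a.
Arguments TrueE {Sg V}.
Arguments FalseE {Sg V}.

Definition bind_map (Sg : signature) (V W : sorts Sg -> Type) (s : sorts Sg)
    (r : forall t, V t -> W t) (t : sorts Sg) (x : bind V s t) : bind W s t :=
  match x with
  | Bound => Bound
  | Free _ y => Free (r _ y)
  end.

Fixpoint rename (Sg : signature) (V W : sorts Sg -> Type)
    (r : forall t, V t -> W t) (s : sorts Sg) (e : expr V s) : expr W s :=
  match e with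
  | Var _ x => Var (r _ x)
  | App f a => App f (fun k => rename r (a k))
  | Eq _ a b => Eq (rename r a) (rename r b)
  | TrueE => TrueE
  | FalseE => FalseE
  | Not a => Not (rename r a)
  | And a b => And (rename r a) (rename r b)
  | Or a b => Or (rename r a) (rename r b)
  | Imp a b => Imp (rename r a) (rename r b)
  | Iff a b => Iff (rename r a) (rename r b)
  | Forall _ a => Forall (rename (bind_map r) a)
  | Exists _ a => Exists (rename (bind_map r) a)
  end.

(* The sort [Bool] is always interpreted by [bool]. *)
Definition carrier_of (U : Type) (D : U -> Type) (s : sort_of U) : Type :=
  match s with Bool => bool | Base u => D u end.

Record structure (Sg : signature) := Structure {
  dom : base_sort Sg -> Type;
  interp : forall f : fsym Sg,
    (forall k : 'I_(arity f), carrier_of dom (arg_sort k)) ->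
    carrier_of dom (res_sort f)
}.

Definition carrier (Sg : signature) (M : structure Sg) (s : sorts Sg) : Type :=
  carrier_of (dom M) s.

Definition valuation (Sg : signature) (M : structure Sg)
    (V : sorts Sg -> Type) : Type :=
  forall s : sorts Sg, V s -> carrier M s.

Definition bind_val (Sg : signature) (M : structure Sg) (V : sorts Sg -> Type)
    (s : sorts Sg) (v : valuation M V) (d : carrier M s) :
    valuation M (bind V s) :=
  fun t x =>
    match x in bind _ _ t return carrier M t with
    | Bound => d
    | Free _ y => v _ y
    end.

Fixpoint eval (Sg : signature) (M : structure Sg) (V : sorts Sg -> Type)
    (s : sorts Sg) (e : expr V s) : valuation M V -> carrier M s :=
  match e in expr _ s return valuation M V -> carrier M s with
  | Var _ x => fun v => v _ x
  | App f a => fun v => interp (fun k => eval (a k) v)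
  | Eq _ a b => fun v => `[< eval a v = eval b v >]
  | TrueE => fun=> true
  | FalseE => fun=> false
  | Not a => fun v => ~~ eval a v
  | And a b => fun v => eval a v && eval b v
  | Or a b => fun v => eval a v || eval b v
  | Imp a b => fun v => eval a v ==> eval b v
  | Iff a b => fun v => (eval a v : bool) == eval b v
  | Forall _ a => fun v => `[< forall d, eval a (bind_val v d) = true >]
  | Exists _ a => fun v => `[< exists d, eval a (bind_val v d) = true >]
  end.

Definition sat (Sg : signature) (M : structure Sg) (V : sorts Sg -> Type)
    (v : valuation M V) (e : expr V Bool) : bool :=
  eval e v.

Inductive stmt (Sg : signature) (V : sorts Sg -> Type) : Type :=
| Assume (e : expr V Bool).

Definition rename_stmt (Sg : signature) (V W : sorts Sg -> Type)
    (r : forall t, V t -> W t) (c : stmt V) : stmt W :=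
  let: Assume e := c in Assume (rename r e).

(* A program over the variables [X] with blocks 0, ..., n.  The initial block
   is [ord0] (it is not required to be without predecessors), the final block
   is [ord_max]; they coincide when n = 0. *)
Record program (Sg : signature) (X : sorts Sg -> Type) (n : nat) := Program {
  stmts : 'I_n.+1 -> seq (stmt X);
  succ : 'I_n.+1 -> {set 'I_n.+1};
  succ_final : forall i, (succ i == set0) = (i == ord_max)
}.

Definition pre (Sg : signature) (X : sorts Sg -> Type) (n : nat)
    (P : program X n) (i : 'I_n.+1) : {set 'I_n.+1} :=
  [set j | i \in succ P j].

Definition edge (Sg : signature) (X : sorts Sg -> Type) (n : nat)
    (P : program X n) : rel 'I_n.+1 :=
  fun i j => j \in succ P i.

Definition loop_free (Sg : signature) (X : sorts Sg -> Type) (n : nat)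
    (P : program X n) : Prop :=
  forall c : seq 'I_n.+1, cycle (edge P) c -> c = [::].

Definition complete_path (Sg : signature) (X : sorts Sg -> Type) (n : nat)
    (P : program X n) (p : seq 'I_n.+1) : bool :=
  if p is i :: q then [&& i == ord0, path (edge P) i q & last i q == ord_max]
  else false.

Definition feasible (Sg : signature) (M : structure Sg)
    (X : sorts Sg -> Type) (n : nat) (P : program X n) (sigma : valuation M X)
    (p : seq 'I_n.+1) : bool :=
  all (fun i => all (fun c => let: Assume e := c in sat sigma e) (stmts P i)) p.

Definition wlp1 (Sg : signature) (V : sorts Sg -> Type) (c : stmt V)
    (Q : expr V Bool) : expr V Bool :=
  let: Assume e := c in Imp e Q.

Definition wlp (Sg : signature) (V : sorts Sg -> Type) (S : seq (stmt V))
    (Q : expr V Bool) : expr V Bool :=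
  foldr (@wlp1 Sg V) Q S.

(* The program variables together with the fresh Boolean variables. *)
Inductive vcvar (Sg : signature) (X : sorts Sg -> Type) (n : nat) :
    sorts Sg -> Type :=
| ProgVar (s : sorts Sg) (x : X s) : vcvar X n s
| BVar (i : 'I_n.+1) : vcvar X n Bool
| RVar (i : 'I_n.+1) : vcvar X n Bool.
Arguments ProgVar {Sg X n s} x.
Arguments BVar {Sg X n} i.
Arguments RVar {Sg X n} i.

Definition extends (Sg : signature) (M : structure Sg) (X : sorts Sg -> Type)
    (n : nat) (nu : valuation M (vcvar X n)) (sigma : valuation M X) : Prop :=
  forall (s : sorts Sg) (x : X s), nu s (ProgVar x) = sigma s x.

(* The statements of a block, seen over the extended set of variables. *)
Definition vc_stmts (Sg : signature) (X : sorts Sg -> Type) (n : nat)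
    (P : program X n) (i : 'I_n.+1) : seq (stmt (vcvar X n)) :=
  [seq rename_stmt (fun s x => ProgVar x) c | c <- stmts P i].

Definition WLP (Sg : signature) (X : sorts Sg -> Type) (n : nat)
    (P : program X n) : expr (vcvar X n) Bool :=
  And
    (\big[@And Sg (vcvar X n)/TrueE]_(i < n.+1 | i < n)
       Iff (Var (BVar i))
           (Not (wlp (vc_stmts P i)
              (\big[@And Sg (vcvar X n)/TrueE]_(j in succ P i)
                 Not (Var (BVar j))))))
    (Iff (Var (BVar ord_max)) (Not (wlp (vc_stmts P ord_max) FalseE))).

Definition VC (Sg : signature) (X : sorts Sg -> Type) (n : nat)
    (P : program X n) : expr (vcvar X n) Bool :=
  And (WLP P)
    (And
      (Iff (Var (RVar ord0)) (Var (BVar ord0)))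
      (\big[@And Sg (vcvar X n)/TrueE]_(i < n.+1 | 0 < i)
         Iff (Var (RVar i))
             (And (Var (BVar i))
                (\big[@Or Sg (vcvar X n)/FalseE]_(j in pre P i)
                   Var (RVar j))))).

(* Main.v *)
(* Since the graph is acyclic, the constraints [VC] determine the auxiliary
   variables from the program variables, by recursion along the edges (for the
   [B_i]) and against them (for the [R_i]).  The unique solution is: [B_i] says
   that some feasible path leads from block i to the final block, and [R_i]
   says in addition that some feasible path leads from block 0 to block i. *)
Require Import Defs.
From mathcomp Require Import all_boot.
From mathcomp Require Import boolp.

Set Implicit Arguments.
Unset Strict Implicit.
Unset Printing Implicit Defensive.

(** Needed because the assumptions of [P] enter [VC] renamed along [ProgVar]. The induction keeps
    [W], [r], [v], [w] general, since a quantifier replaces all of them by their versions with one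
    more bound variable. *)
Lemma eval_rename (Sg : signature) (M : structure Sg)
    (V W : sorts Sg -> Type) (r : forall t, V t -> W t) (s : sorts Sg)
    (e : expr V s) (v : valuation M V) (w : valuation M W) :
  (forall t (x : V t), w t (r t x) = v t x) ->
  eval (rename r e) w = eval e v.
Proof.
elim: e W r v w => {s V} /=.
- by move=> V s x W r v w rvw; apply: rvw.
- move=> V f a IH W r v w rvw; congr (interp _).
  by apply: functional_extensionality_dep => k; apply: IH.
- by move=> V s a IHa b IHb W r v w rvw; rewrite (IHa _ _ v) // (IHb _ _ v).
- by [].
- by [].
- by move=> V a IHa W r v w rvw; rewrite (IHa _ _ v).
- by move=> V a IHa b IHb W r v w rvw; rewrite (IHa _ _ v) // (IHb _ _ v).
- by move=> V a IHa b IHb W r v w rvw; rewrite (IHa _ _ v) // (IHb _ _ v).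
- by move=> V a IHa b IHb W r v w rvw; rewrite (IHa _ _ v) // (IHb _ _ v).
- by move=> V a IHa b IHb W r v w rvw; rewrite (IHa _ _ v) // (IHb _ _ v).
- move=> V s a IHa W r v w rvw; apply: asbool_equiv_eq.
  have E d : eval (rename (bind_map r) a) (bind_val w d) =
             eval a (bind_val v d) by apply: IHa => t [|t' x] /=.
  by split=> H d; move: (H d); rewrite E.
- move=> V s a IHa W r v w rvw; apply: asbool_equiv_eq.
  have E d : eval (rename (bind_map r) a) (bind_val w d) =
             eval a (bind_val v d) by apply: IHa => t [|t' x] /=.
  by split=> -[d H]; exists d; move: H; rewrite E.
Qed.

Lemma satE (Sg : signature) (M : structure Sg) (V : sorts Sg -> Type)
    (v : valuation M V) :
  (forall x : V Bool, sat v (Var x) = v Bool x) *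
  (sat v FalseE = false) *
  (forall a, sat v (Not a) = ~~ sat v a) *
  (forall a b, sat v (And a b) = sat v a && sat v b) *
  (forall a b, sat v (Imp a b) = sat v a ==> sat v b) *
  (forall a b, sat v (Iff a b) = (sat v a == sat v b)).
Proof. by []. Qed.

Lemma sat_bigAnd (Sg : signature) (M : structure Sg) (V : sorts Sg -> Type)
    (v : valuation M V) (I : finType) (p : pred I) (F : I -> expr V Bool) :
  sat v (\big[@And Sg V/TrueE]_(i | p i) F i) = [forall (i | p i), sat v (F i)].
Proof. by rewrite (big_morph (sat v) (id1 := true) (op1 := andb)) // big_andE. Qed.

Lemma sat_bigOr (Sg : signature) (M : structure Sg) (V : sorts Sg -> Type)
    (v : valuation M V) (I : finType) (p : pred I) (F : I -> expr V Bool) :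
  sat v (\big[@Or Sg V/FalseE]_(i | p i) F i) = [exists (i | p i), sat v (F i)].
Proof. by rewrite (big_morph (sat v) (id1 := false) (op1 := orb)) // big_orE. Qed.

(** Induction on the number of vertices reachable from [i]. Along an edge from [i] to [j] this set
    shrinks strictly: it loses [i], as a path from [j] back to [i] would close a cycle. *)
Lemma acyclic_ind (T : finType) (e : rel T) (A : T -> Prop) :
  (forall c, cycle e c -> c = [::]) ->
  (forall i, (forall j, e i j -> A j) -> A i) -> forall i, A i.
Proof.
move=> acyc step i.
have [k] := ubnP #|[set j | connect e i j]|.
elim: k i => // k IH i; rewrite ltnS => le_k; apply: step => j eij.
apply: IH; apply: leq_trans le_k; apply: proper_card; apply/properP; split.
  by apply/subsetP=> x; rewrite !inE; apply: connect_trans; apply: connect1.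
exists i; rewrite !inE ?connect0 //; apply/negP => /connectP[p ep iE].
suff /acyc : cycle e (j :: p) by [].
by rewrite /= rcons_path ep -iE.
Qed.

Lemma acyclic_coind (T : finType) (e : rel T) (A : T -> Prop) :
  (forall c, cycle e c -> c = [::]) ->
  (forall i, (forall j, e j i -> A j) -> A i) -> forall i, A i.
Proof.
move=> acyc; apply: (@acyclic_ind _ (fun i j => e j i)) => c cyc_c.
by rewrite -(revK c) (acyc (rev c)) // rev_cycle.
Qed.

Section Solution.
Variables (Sg : signature) (M : structure Sg) (X : sorts Sg -> Type) (n : nat).
Variables (P : program X n) (sigma : valuation M X).

Definition passes (i : 'I_n.+1) : bool := feasible P sigma [:: i].

Lemma feasibleE p : feasible P sigma p = all passes p.
Proof. by apply: eq_all => i; rewrite /passes /= andbT. Qed.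

Definition reaches_final (i : 'I_n.+1) : Prop :=
  exists q, [/\ path (edge P) i q, last i q = ord_max & all passes (i :: q)].

(* Block i itself is not required to pass; [reaches_final] takes care of it. *)
Definition reached (i : 'I_n.+1) : Prop :=
  exists q, [/\ path (edge P) ord0 q, last ord0 q = i &
                all passes (belast ord0 q)].

(** The nested implications built by [wlp] collapse to a single one, and the assumptions mention
    program variables only, where [nu] agrees with [sigma]. *)
Lemma sat_wlp (nu : valuation M (vcvar X n)) i (Q : expr (vcvar X n) Bool) :
  extends nu sigma ->
  sat nu (wlp (vc_stmts P i) Q) = passes i ==> sat nu Q.
Proof.
move=> ext; rewrite /passes /feasible /vc_stmts /= andbT.
elim: (stmts P i) => [|[e] S IH] //=.
rewrite satE {}IH /sat (@eval_rename _ _ _ _ _ _ _ sigma) //.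
by case: (eval e sigma).
Qed.

(** Turns the formula into Boolean recursion equations. The disjunct [i == ord_max] absorbs the
    separate clause for the final block. *)
Lemma sat_VC (nu : valuation M (vcvar X n)) : extends nu sigma ->
  sat nu (VC P) <->
  [/\ forall i, nu Bool (BVar i) =
        passes i && ((i == ord_max) || [exists j in succ P i, nu Bool (BVar j)]),
      nu Bool (RVar ord0) = nu Bool (BVar ord0) &
      forall i : 'I_n.+1, 0 < i -> nu Bool (RVar i) =
        nu Bool (BVar i) && [exists j in pre P i, nu Bool (RVar j)]].
Proof.
move=> ext.
(* [sat] is pushed through the connectives: a negated implication becomes a conjunction, a negated
   conjunction of negations an existential. *)
have -> : sat nu (VC P) =
  ([forall (i : 'I_n.+1 | i < n), nu Bool (BVar i) ==
      passes i && [exists j in succ P i, nu Bool (BVar j)]] &&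
   (nu Bool (BVar ord_max) == passes ord_max)) &&
  ((nu Bool (RVar ord0) == nu Bool (BVar ord0)) &&
   [forall (i : 'I_n.+1 | 0 < i), nu Bool (RVar i) ==
        nu Bool (BVar i) && [exists j in pre P i, nu Bool (RVar j)]]).
  rewrite /VC /WLP !satE !sat_bigAnd sat_wlp // satE implybF negbK.
  congr (_ && _ && (_ && _)); apply: eq_forallb => i; congr (_ ==> _).
    rewrite !satE sat_wlp // sat_bigAnd negb_imply; congr (_ == _ && _).
    by rewrite negb_forall_in; apply: eq_existsb => j; rewrite !satE negbK.
  by rewrite !satE sat_bigOr.
have lt_max (i : 'I_n.+1) : (i < n) = (i != ord_max).
  by rewrite ltn_neqAle -ltnS ltn_ord andbT.
split.
  case/andP=> /andP[/forall_inP HB /eqP Hn] /andP[/eqP H0 /forall_inP HR].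
  split=> // [i | i i_gt0]; last exact/eqP/HR.
  have [-> | ne_i] := eqVneq; first by rewrite Hn andbT.
  by apply/eqP/HB; rewrite lt_max.
case=> HB H0 HR; apply/andP; split; apply/andP; split.
- apply/forall_inP => i; rewrite lt_max => /negPf ne_i.
  by rewrite [X in X == _]HB ne_i.
- by rewrite HB eqxx andbT.
- exact/eqP.
- by apply/forall_inP => i /HR ->.
Qed.

(** Splitting off the first edge of a path shows that the intended meaning of [B_i] obeys the
    recursion equation for [B_i]. *)
Lemma reaches_finalE i :
  `[< reaches_final i >] =
  passes i && ((i == ord_max) || [exists j in succ P i, `[< reaches_final j >]]).
Proof.
apply/asboolP/andP => [[[|j q] /= [epath lst]]|[pi /orP[/eqP i_max|]]].
- by rewrite andbT => ->; rewrite lst eqxx.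
- case/andP: epath => eij epath /and3P[-> pj pq]; split=> //.
  apply/orP; right; apply/exists_inP; exists j => //.
  by apply/asboolP; exists q; split=> //=; rewrite pj.
- by exists [::]; rewrite /= pi.
- case/exists_inP=> j eij /asboolP[q [epath lst pq]].
  by exists (j :: q); split=> //; [rewrite /= epath andbT | rewrite /= pi].
Qed.

(** As [i] is not the initial block, a path to it has a last edge, from some [j]; prepending that
    edge to a path from [i] to the final block gives [reaches_final j]. *)
Lemma reached_pre (i : 'I_n.+1) : 0 < i -> reaches_final i ->
  reached i <-> exists2 j, j \in pre P i & reaches_final j /\ reached j.
Proof.
move=> i_gt0 [r [epr lst_r pr]]; split=> [[q]|[j]].
  case/lastP: q => [[_ /= i0]|q k]; first by rewrite -i0 in i_gt0.
  rewrite last_rcons rcons_path belast_rcons lastI all_rcons.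
  case=> /andP[epq ei] ki /andP[pj pq]; rewrite ki in ei; exists (last ord0 q).
    by rewrite inE.
  by split; [exists (i :: r); split=> //=; rewrite ?pj //; apply/andP
            | exists q].
(* From [reaches_final j] only [passes j] is kept: [reached j] does not contain it, but the path
   extended to [i] must pass [j]. *)
rewrite inE => eji [[_ [_ _ /andP[pj _]]] [q [epq lst_q pq]]].
exists (rcons q i); rewrite last_rcons rcons_path belast_rcons lastI all_rcons.
by rewrite lst_q epq pj pq.
Qed.

(** Cut or glue a path at an occurrence of [i]. Since [reached] omits the test of its end block, the
    tests of the two halves together cover the path. *)
Lemma complete_path_through i :
  reaches_final i /\ reached i <->
  exists p, [/\ complete_path P p, feasible P sigma p & i \in p].
Proof.
split=> [[[r [epr lst_r pr]] [q [epq lst_q pq]]]|[[|k q] []] //].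
  exists (ord0 :: q ++ r); rewrite feasibleE; split.
  - by rewrite /= cat_path last_cat lst_q epq epr lst_r !eqxx.
  - by rewrite -cat_cons lastI lst_q cat_rcons all_cat pq.
  - by rewrite -cat_cons lastI lst_q cat_rcons mem_cat mem_head orbT.
rewrite feasibleE => /and3P[/eqP -> epq /eqP lst_q] pq /splitPl iq.
case: iq epq lst_q pq => q1 q2 lst_q1.
rewrite cat_path last_cat -cat_cons lastI cat_rcons all_cat lst_q1.
by case/andP=> ep1 ep2 lst_q2 /andP[p1 p2]; split; [exists q2 | exists q1].
Qed.

Lemma VC_solution (nu : valuation M (vcvar X n)) :
  loop_free P -> extends nu sigma ->
  sat nu (VC P) <->
  (forall i, nu Bool (BVar i) = `[< reaches_final i >]) /\
  (forall i, nu Bool (RVar i) = `[< reaches_final i /\ reached i >]).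
Proof.
move=> acyc ext; apply: (iff_trans (sat_VC ext)).
have reached0 : reached ord0 by exists [::].
have RE (i : 'I_n.+1) : 0 < i -> `[< reaches_final i /\ reached i >] =
    `[< reaches_final i >] &&
    [exists j in pre P i, `[< reaches_final j /\ reached j >]].
  move=> i_gt0; rewrite asbool_and; case: asboolP => //= fi.
  apply/asboolP/exists_inP => [/(reached_pre i_gt0 fi)[j ji Rj]|[j ji Rj]].
    by exists j => //; apply/asboolP.
  by apply/(reached_pre i_gt0 fi); exists j => //; apply/asboolP.
split=> [[HB H0 HR] | [HB HR]].
  have BE i : nu Bool (BVar i) = `[< reaches_final i >].
    (* Both sides obey the same recursion, and the induction hypothesis identifies them on the
       successors. *)
    move: i; apply: (acyclic_ind acyc) => i IH; rewrite HB reaches_finalE.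
    by congr (_ && (_ || _)); apply: eq_existsb => j; apply: andb_id2l => /IH.
  split=> //; apply: (acyclic_coind acyc) => i IH.
  have [i0 | i_gt0] := posnP i.
    have -> : i = ord0 by apply: val_inj.
    (* The initial block is reached by the empty path, so only [reaches_final] remains, as in
       [B_0]. *)
    by rewrite H0 BE; apply: asbool_equiv_eq; split=> [|[]].
  rewrite HR // BE RE //; congr (_ && _); apply: eq_existsb => j.
  by apply: andb_id2l; rewrite inE => /IH.
split=> [i | | i i_gt0].
- rewrite HB reaches_finalE; congr (_ && (_ || _)).
  by apply: eq_existsb => j; rewrite HB.
- by rewrite HB HR; apply: asbool_equiv_eq; split=> [[]|].
- rewrite HB HR RE //; congr (_ && _); apply: eq_existsb => j.
  by rewrite HR.
Qed.

Definition solution : valuation M (vcvar X n) := fun s x =>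
  match x in vcvar _ _ s return carrier M s with
  | ProgVar _ y => sigma y
  | BVar i => `[< reaches_final i >]
  | RVar i => `[< reaches_final i /\ reached i >]
  end.

End Solution.

Theorem theorem3 (Sg : signature) (M : structure Sg) (X : sorts Sg -> Type)
    (n : nat) (P : program X n) (hP : loop_free P) (sigma : valuation M X) :
  ((exists nu : valuation M (vcvar X n),
      [/\ extends nu sigma, sat nu (VC P) & nu Bool (RVar ord0) = true]) <->
   (exists p : seq 'I_n.+1, complete_path P p /\ feasible P sigma p))
  /\
  (forall nu : valuation M (vcvar X n),
      extends nu sigma -> sat nu (VC P) -> nu Bool (RVar ord0) = true ->
      forall i : 'I_n.+1,
        nu Bool (RVar i) = true <->
        exists p : seq 'I_n.+1,
          [/\ complete_path P p, feasible P sigma p & i \in p]).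
Proof.
have RE (nu : valuation M (vcvar X n)) i : extends nu sigma -> sat nu (VC P) ->
    nu Bool (RVar i) = true <->
    exists p, [/\ complete_path P p, feasible P sigma p & i \in p].
  move=> ext /(VC_solution hP ext)[_ ->].
  by rewrite -complete_path_through; split=> /asboolP.
split=> [|nu ext sat_nu _ i]; last exact: RE.
(* The existence claim is the case [i = ord0] of [RE]. *)
split=> [[nu [ext sat_nu /(RE _ _ ext sat_nu)[p []]]]|[p [cp fp]]].
  by exists p.
have ext : extends (solution P sigma) sigma by [].
have sat_sol : sat (solution P sigma) (VC P) by apply/(VC_solution hP ext).
exists (solution P sigma); split=> //; apply/(RE _ _ ext sat_sol).
(* A complete path starts in, and hence visits, the initial block. *)
exists p; split=> //; case: p cp {fp} => // i q /and3P[/eqP -> _ _].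
exact: mem_head.
Qed.
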